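(* Let $K$ be a field, let $1\le s\le r+1\le n$ be integers with $n\ge 2$, and let $S'=K[x_1,\ldots,x_r]$, $S''=K[x_s,\ldots,x_n]$, $S=K[x_1,\ldots,x_n]$ and $p=r-s+1$. Let $I\subset S'$ and $J\subset S''$ be two monomial ideals, and let $IS$, $JS$ denote the ideals they generate in $S$. Then: (1) $\operatorname{sdepth}_S(IS\cap JS)\ge\operatorname{sdepth}_{S'}(I)+\operatorname{sdepth}_{S''}(J)-p=\operatorname{sdepth}_S(IS)+\operatorname{sdepth}_S(JS)-n$. (2) $\operatorname{sdepth}_S(S/(IS+JS))\ge\operatorname{sdepth}_{S'}(S'/I)+\operatorname{sdepth}_{S''}(S''/J)-p=\operatorname{sdepth}_S(S/IS)+\operatorname{sdepth}_S(S/JS)-n$. (3) $\operatorname{sdepth}_S(IS+JS)\ge\min\{\operatorname{sdepth}_S(IS),\ \operatorname{sdepth}_{S''}(J)+\operatorname{sdepth}_{S'}(S'/I)-p\}=\min\{\operatorname{sdepth}_S(IS),\ \operatorname{sdepth}_S(JS)+\operatorname{sdepth}_S(S/IS)-n\}$. (4) $\operatorname{sdepth}_S(S/(IS\cap JS))\ge\min\{\operatorname{sdepth}_S(S/IS),\ \operatorname{sdepth}_{S''}(S''/J)+\operatorname{sdepth}_{S'}(I)-p\}=\min\{\operatorname{sdepth}_S(S/IS),\ \operatorname{sdepth}_S(S/JS)+\operatorname{sdepth}_S(IS)-n\}$.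
   Context: Let $R$ be a polynomial ring over a field $K$ in a finite set of variables $X$, with its multigrading by exponent vectors, and let $M$ be a multigraded $R$-module. A Stanley decomposition of $M$ is a direct sum decomposition of $K$-vector spaces $\mathcal D: M=\bigoplus_{i=1}^t m_iK[Z_i]$, where $m_i\in M$ and $Z_i\subset X$ are such that $m_iK[Z_i]$ is a free $K[Z_i]$-module. Put $\operatorname{sdepth}(\mathcal D)=\min_{i=1}^t|Z_i|$. The Stanley depth $\operatorname{sdepth}_R(M)$ is the maximum of $\operatorname{sdepth}(\mathcal D)$ over all Stanley decompositions $\mathcal D$ of $M$. *)

(* Defs.v *)
From HB Require Import structures.
From mathcomp Require Import all_boot all_order all_algebra.
From mathcomp Require Import mpoly.
From mathcomp Require Import boolp classical_sets constructive_ereal.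

Set Implicit Arguments.
Unset Strict Implicit.
Unset Printing Implicit Defensive.

Import Order.TTheory GRing.Theory Num.Theory.
Local Open Scope classical_set_scope.
Local Open Scope ring_scope.
Local Open Scope quotient_scope.

Notation mdegree n := {ffun 'I_n -> int}.

Definition zexp (n : nat) (m : 'X_{1..n}) : mdegree n := [ffun i => (m i)%:Z].

Section Multigraded.
Variables (K : fieldType) (n : nat).

Definition is_multigrading (M : lmodType {mpoly K[n]})
    (comp : mdegree n -> set M) : Prop :=
  [/\ forall a, comp a 0,
      forall a (c : K) x y, comp a x -> comp a y -> comp a (c%:MP *: x + y),
      forall a m x, comp a x -> comp (zexp m + a) ('X_[m] *: x),
      forall x, exists (s : seq (mdegree n)) (f : mdegree n -> M),
        (forall a, comp a (f a)) /\ x = \sum_(a <- s) f a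
    & forall (s : seq (mdegree n)) (f : mdegree n -> M), uniq s ->
        (forall a, comp a (f a)) -> \sum_(a <- s) f a = 0 ->
        {in s, forall a, f a = 0}].

Record mgmodule := MgModule {
  mg_sort :> lmodType {mpoly K[n]};
  mg_comp : mdegree n -> set mg_sort;
  mg_compP : is_multigrading mg_comp }.

(* K[Z] *)
Definition polyK (Z : {set 'I_n}) : set {mpoly K[n]} :=
  [set f | forall m, m \in msupp f -> forall i, m i != 0%N -> i \in Z].

Definition stanley_space (M : lmodType {mpoly K[n]}) (u : M) (Z : {set 'I_n}) :
  set M := [set f *: u | f in polyK Z].

(* M is multigraded, so the u_i = sd_gen i are taken homogeneous. sd_free says
   that u_i is a K[Z_i]-basis of u_i K[Z_i] (in particular u_i != 0); sd_span
   and sd_direct say that M is the direct sum of the u_i K[Z_i]. *)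
Record stanley_dec (M : mgmodule) := StanleyDec {
  sd_size : nat;
  sd_gen : 'I_sd_size -> M;
  sd_vars : 'I_sd_size -> {set 'I_n};
  sd_homog : forall i, exists a, mg_comp a (sd_gen i);
  sd_free : forall i f, polyK (sd_vars i) f -> f *: sd_gen i = 0 -> f = 0;
  sd_span : forall x : M, exists y : 'I_sd_size -> M,
    (forall i, stanley_space (sd_gen i) (sd_vars i) (y i)) /\ x = \sum_i y i;
  sd_direct : forall y : 'I_sd_size -> M,
    (forall i, stanley_space (sd_gen i) (sd_vars i) (y i)) ->
    \sum_i y i = 0 -> forall i, y i = 0 }.
Arguments sd_gen {M} s i.
Arguments sd_vars {M} s i.

Definition sdepth_dec (M : mgmodule) (D : stanley_dec M) : \bar int :=
  \big[mine/+oo%E]_(i < sd_size D) (#|sd_vars D i|%:Z)%:E.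

(* The only Stanley decomposition of the zero module is the empty one, whose
   minimum is +oo, so sdepth 0 = +oo. All the sdepth_dec D lie in
   {0, ..., n, +oo}, so the default -oo is only taken when M has no Stanley
   decomposition at all. *)
Definition sdepth (M : mgmodule) : \bar int :=
  xget (-oo)%E [set d | (exists D : stanley_dec M, sdepth_dec D = d) /\
                        forall D : stanley_dec M, (sdepth_dec D <= d)%E].

Definition is_ideal (I : set {mpoly K[n]}) : Prop :=
  [/\ I 0, forall f g, I f -> I g -> I (f + g) & forall a f, I f -> I (a * f)].

Definition ideal_gen (A : set {mpoly K[n]}) : set {mpoly K[n]} :=
  smallest is_ideal A.

Record mon_ideal := MonIdeal {
  mi_set :> set {mpoly K[n]};
  mi_gen : exists G : set 'X_{1..n}, mi_set = ideal_gen [set 'X_[m] | m in G] }.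

Lemma ideal_gen_ideal A : is_ideal (ideal_gen A).
Proof.
split=> [B [[]] //|f g If Ig B BA|a f If B BA].
  by case: (BA) => -[_ BD _] _; apply: BD; [exact: If|exact: Ig].
by case: (BA) => -[_ _ BM] _; apply: BM; exact: If.
Qed.

Lemma mi_ideal (I : mon_ideal) : is_ideal I.
Proof. by case: I => I /= [G ->]; apply: ideal_gen_ideal. Qed.

Lemma ideal_sum (I : set {mpoly K[n]}) (T : eqType) (s : seq T) (P : pred T)
    (F : T -> {mpoly K[n]}) : is_ideal I ->
  {in s, forall i, P i -> I (F i)} -> I (\sum_(i <- s | P i) F i).
Proof.
move=> [I0 ID _] IF; rewrite big_seq_cond; apply: big_ind => // i /andP[].
exact: IF.
Qed.

Lemma ideal_supp (I : set {mpoly K[n]}) f : is_ideal I ->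
  (forall m, m \in msupp f -> I 'X_[m]) -> I f.
Proof.
move=> Iid If; rewrite (mpolyE f); apply: ideal_sum => // m mf _.
by rewrite -mul_mpolyC; case: Iid => _ _; apply; apply: If.
Qed.

Lemma mi_supp (I : mon_ideal) f m :
  mi_set I f -> m \in msupp f -> mi_set I 'X_[m].
Proof.
suff: I `<=` [set g | forall k, k \in msupp g -> mi_set I 'X_[k]].
  by move=> /[apply]; apply.
case: (mi_ideal I) => I0 ID IM; case: (mi_gen I) => G IG.
rewrite [X in X `<=` _]IG; apply: smallest_sub; first split=> /=.
- by move=> k; rewrite mcoeff_msupp mcoeff0 eqxx.
- by move=> g h Hg Hh k /msuppD_le; rewrite mem_cat => /orP[/Hg|/Hh].
- move=> a g Hg k /msuppM_le /allpairsP[[k1 k2] /= [_ /Hg Ik2 ->]].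
  by rewrite mpolyXD; apply: IM.
- move=> _ /= [k Gk <-] j /mem_msuppXP <-; rewrite IG.
  by apply: sub_gen_smallest; exists k.
Qed.

Lemma supp_mon_ideal (I : set {mpoly K[n]}) : is_ideal I ->
  (forall f m, I f -> m \in msupp f -> I 'X_[m]) ->
  exists G : set 'X_{1..n}, I = ideal_gen [set 'X_[m] | m in G].
Proof.
move=> Iid Isupp; exists [set m | I 'X_[m]]; apply/seteqP; split=> [f If|].
  apply: ideal_supp; first exact: ideal_gen_ideal.
  by move=> m mf; apply: sub_gen_smallest; exists m => //; apply: Isupp mf.
by apply: smallest_sub => // _ [m /= Im <-].
Qed.

Section CapAdd.
Variables I J : mon_ideal.

Lemma cap_subproof :
  exists G : set 'X_{1..n}, I `&` J = ideal_gen [set 'X_[m] | m in G].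
Proof.
have [I0 ID IM] := mi_ideal I; have [J0 JD JM] := mi_ideal J.
apply: supp_mon_ideal; first split=> //.
- by move=> f g [? ?] [? ?]; split; [exact: ID|exact: JD].
- by move=> a f [? ?]; split; [exact: IM|exact: JM].
- by move=> f m [If Jf] mf; split; [exact: mi_supp If mf|exact: mi_supp Jf mf].
Qed.

Definition mi_cap := MonIdeal cap_subproof.

Lemma add_subproof : exists G : set 'X_{1..n},
  [set f + g | f in I & g in J] = ideal_gen [set 'X_[m] | m in G].
Proof.
have [I0 ID IM] := mi_ideal I; have [J0 JD JM] := mi_ideal J.
apply: supp_mon_ideal; first split=> //.
- by exists 0 => //; exists 0 => //; rewrite addr0.
- move=> _ _ [f If [g Jg <-]] [f' If' [g' Jg' <-]].
  exists (f + f'); first exact: ID.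
  by exists (g + g'); [exact: JD|rewrite addrACA].
- move=> a _ [f If [g Jg <-]]; exists (a * f); first exact: IM.
  by exists (a * g); [exact: JM|rewrite mulrDr].
- move=> _ m [f If [g Jg <-]] /msuppD_le; rewrite mem_cat => /orP[mf|mg].
    by exists 'X_[m]; [exact: mi_supp If mf|exists 0 => //; rewrite addr0].
  by exists 0 => //; exists 'X_[m]; [exact: mi_supp Jg mg|rewrite add0r].
Qed.

Definition mi_add := MonIdeal add_subproof.

End CapAdd.

(* R_a *)
Definition mhomog (a : mdegree n) : set {mpoly K[n]} :=
  [set f | forall m, m \in msupp f -> zexp m = a].

Lemma zexp_inj : injective (@zexp n).
Proof.
move=> m k /ffunP mk; apply/mnmP => i.
by have := mk i; rewrite !ffunE => -[].
Qed.

Lemma zexpD (m k : 'X_{1..n}) : zexp (m + k)%MM = zexp m + zexp k.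
Proof. by apply/ffunP => i; rewrite !ffunE mnmDE PoszD. Qed.

Lemma mhomog0 a : mhomog a 0.
Proof. by move=> m; rewrite mcoeff_msupp mcoeff0 eqxx. Qed.

Lemma mhomog_lin a (c : K) f g : mhomog a f -> mhomog a g ->
  mhomog a (c%:MP * f + g).
Proof.
move=> fa ga m /msuppD_le; rewrite mem_cat mul_mpolyC.
by move=> /orP[/msuppZ_le/fa|/ga].
Qed.

Lemma mhomogX a m f : mhomog a f -> mhomog (zexp m + a) ('X_[m] * f).
Proof.
move=> fa k /msuppM_le /allpairsP[[k1 k2] /= [/mem_msuppXP <- /fa <- ->]].
exact: zexpD.
Qed.

Definition mpart (f : {mpoly K[n]}) (a : mdegree n) : {mpoly K[n]} :=
  \sum_(m <- msupp f | zexp m == a) f@_m *: 'X_[m].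

Lemma mhomog_mpart f a : mhomog a (mpart f a).
Proof.
rewrite /mpart; apply: big_ind => [|g h|m /eqP ma].
- exact: mhomog0.
- by move=> ga ha k /msuppD_le; rewrite mem_cat => /orP[/ga|/ha].
- by move=> k /msuppZ_le /mem_msuppXP <-.
Qed.

Lemma mpart_mon_ideal (I : mon_ideal) f a : mi_set I f -> mi_set I (mpart f a).
Proof.
move=> If; apply: ideal_sum; first exact: mi_ideal.
move=> m mf _; rewrite -mul_mpolyC; case: (mi_ideal I) => _ _; apply.
exact: mi_supp If mf.
Qed.

Definition mdegs (f : {mpoly K[n]}) : seq (mdegree n) :=
  [seq zexp m | m <- msupp f].

Lemma sum_mpart f : f = \sum_(a <- mdegs f) mpart f a.
Proof.
rewrite /mdegs big_map [LHS]mpolyE; apply: eq_big_seq => m mf.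
rewrite /mpart (big_rem m) //= eqxx big1_seq ?addr0 // => k.
rewrite mem_rem_uniq ?msupp_uniq // inE => /andP[/eqP /zexp_inj ->].
by rewrite eqxx.
Qed.

Lemma mcoeff_mhomog_sum (s : seq (mdegree n))
    (f : mdegree n -> {mpoly K[n]}) m :
  uniq s -> (forall a, mhomog a (f a)) -> zexp m \in s ->
  (\sum_(a <- s) f a)@_m = (f (zexp m))@_m.
Proof.
move=> us fh ms; rewrite raddf_sum (bigD1_seq (zexp m)) //= big1_seq ?addr0 //.
move=> a /andP[am _]; apply/eqP; apply: contraNT am; rewrite -mcoeff_msupp.
by move/fh => ->.
Qed.

Definition ideal_pred (I : mon_ideal) : {mpoly K[n]}^o -> bool :=
  fun f => `[< mi_set I f >].

Fact ideal_pred_submod (I : mon_ideal) : submod_closed (ideal_pred I).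
Proof.
have [I0 ID IM] := mi_ideal I; split; first exact/asboolP.
by move=> a f g /asboolP If /asboolP Ig; apply/asboolP/ID => //; apply: IM.
Qed.

HB.instance Definition _ (I : mon_ideal) :=
  GRing.isZmodClosed.Build _ (ideal_pred I)
    (GRing.submod_closedB (ideal_pred_submod I)).
HB.instance Definition _ (I : mon_ideal) :=
  GRing.isSubmodClosed.Build _ _ (ideal_pred I) (ideal_pred_submod I).

Definition ideal_sort (I : mon_ideal) : Type :=
  {f : {mpoly K[n]}^o | ideal_pred I f}.

HB.instance Definition _ (I : mon_ideal) := [isSub of ideal_sort I for sval].
HB.instance Definition _ (I : mon_ideal) := [Choice of ideal_sort I by <:].
HB.instance Definition _ (I : mon_ideal) :=
  [SubChoice_isSubLmodule of ideal_sort I by <:].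

Definition ideal_comp (I : mon_ideal) (a : mdegree n) : set (ideal_sort I) :=
  [set x | mhomog a (val x)].
Arguments ideal_comp : clear implicits.

Fact ideal_compP (I : mon_ideal) : is_multigrading (ideal_comp I).
Proof.
split=> [a|a c x y xa ya|a m x xa|x|s f us fh fs0 a sa].
- exact: mhomog0.
- exact: mhomog_lin.
- exact: mhomogX.
- have Ix a : ideal_pred I (mpart (val x) a).
    by apply/asboolP/mpart_mon_ideal/asboolP/(valP x).
  exists (mdegs (val x)), (fun a => Sub (mpart (val x) a) (Ix a)); split=> [a|].
    exact: mhomog_mpart.
  apply: val_inj; rewrite raddf_sum /=.
  exact: sum_mpart.
- apply: val_inj; rewrite raddf0; apply/mpolyP => m; rewrite mcoeff0.
  apply/eqP; rewrite mcoeff_eq0; apply/negP => mf.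
  have ma := fh _ _ mf; move: mf; rewrite mcoeff_msupp -ma => /eqP; apply.
  rewrite -(@mcoeff_mhomog_sum s (fun b => val (f b))) ?ma //.
  by rewrite -raddf_sum fs0 raddf0.
Qed.

Definition ideal_module (I : mon_ideal) : mgmodule :=
  MgModule (ideal_compP I).

Definition ideal_zmod (I : mon_ideal) : zmodClosed {mpoly K[n]}^o :=
  GRing.ZmodClosed.clone _ (ideal_pred I) _.

Definition quot_sort (I : mon_ideal) : Type := {ideal_quot (ideal_zmod I)}.

HB.instance Definition _ (I : mon_ideal) := GRing.Zmodule.on (quot_sort I).
HB.instance Definition _ (I : mon_ideal) :=
  EqQuotient.copy (quot_sort I) {ideal_quot (ideal_zmod I)}.
HB.instance Definition _ (I : mon_ideal) :=
  ZmodQuotient.copy (quot_sort I) {ideal_quot (ideal_zmod I)}.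

Definition quot_pi (I : mon_ideal) (f : {mpoly K[n]}) : quot_sort I :=
  \pi_(quot_sort I) (f : {mpoly K[n]}^o).

Definition quot_scale (I : mon_ideal) (a : {mpoly K[n]}) (x : quot_sort I) :
  quot_sort I := quot_pi I (a * repr x).

Lemma quot_piP (I : mon_ideal) f g :
  quot_pi I f = quot_pi I g <-> mi_set I (f - g).
Proof.
split=> [/eqP|Ifg]; first by rewrite -Quotient.idealrBE => /asboolP.
by apply/eqP; rewrite -Quotient.idealrBE; apply/asboolP.
Qed.

Lemma quot_pi_surj (I : mon_ideal) (x : quot_sort I) :
  exists f, x = quot_pi I f.
Proof. by exists (repr x); rewrite /quot_pi reprK. Qed.

Lemma quot_piD (I : mon_ideal) : {morph quot_pi I : f g / f + g}.
Proof. by move=> f g; rewrite /quot_pi raddfD. Qed.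

Lemma quot_pi0 (I : mon_ideal) : quot_pi I 0 = 0.
Proof. by rewrite /quot_pi raddf0. Qed.

Lemma quot_pi_sum (I : mon_ideal) (T : Type) (s : seq T) F :
  quot_pi I (\sum_(i <- s) F i) = \sum_(i <- s) quot_pi I (F i).
Proof. exact: (big_morph _ (@quot_piD I) (quot_pi0 I)). Qed.

Lemma quot_scaleE (I : mon_ideal) a f :
  quot_scale a (quot_pi I f) = quot_pi I (a * f).
Proof.
apply/quot_piP; rewrite -mulrBr; case: (mi_ideal I) => _ _; apply.
by apply/quot_piP; rewrite /quot_pi reprK.
Qed.

Fact quot_scaleA (I : mon_ideal) a b (x : quot_sort I) :
  quot_scale a (quot_scale b x) = quot_scale (a * b) x.
Proof. by have [f ->] := quot_pi_surj x; rewrite !quot_scaleE mulrA. Qed.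

Fact quot_scale1 (I : mon_ideal) : left_id 1 (@quot_scale I).
Proof.
by move=> x; have [f ->] := quot_pi_surj x; rewrite quot_scaleE mul1r.
Qed.

Fact quot_scaleDr (I : mon_ideal) : right_distributive (@quot_scale I) +%R.
Proof.
move=> a x y; have [f ->] := quot_pi_surj x; have [g ->] := quot_pi_surj y.
by rewrite -quot_piD !quot_scaleE mulrDr quot_piD.
Qed.

Fact quot_scaleDl (I : mon_ideal) (x : quot_sort I) :
  {morph (@quot_scale I)^~ x : a b / a + b}.
Proof.
move=> a b; have [f ->] := quot_pi_surj x.
by rewrite !quot_scaleE mulrDl quot_piD.
Qed.

HB.instance Definition _ (I : mon_ideal) :=
  GRing.Zmodule_isLmodule.Build {mpoly K[n]} (quot_sort I)
    (@quot_scaleA I) (@quot_scale1 I) (@quot_scaleDr I) (@quot_scaleDl I).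

Definition quot_comp (I : mon_ideal) (a : mdegree n) : set (quot_sort I) :=
  [set quot_pi I f | f in mhomog a].
Arguments quot_comp : clear implicits.

Fact quot_compP (I : mon_ideal) : is_multigrading (quot_comp I).
Proof.
split=> [a|a c _ _ [f fa <-] [g ga <-]|a m _ [f fa <-]|x|s f us fh fs0 a sa].
- by exists 0; [exact: mhomog0|exact: quot_pi0].
- exists (c%:MP * f + g); first exact: mhomog_lin.
  by rewrite quot_piD -quot_scaleE.
- by exists ('X_[m] * f); [exact: mhomogX|rewrite -quot_scaleE].
- have [f ->] := quot_pi_surj x.
  exists (mdegs f), (fun a => quot_pi I (mpart f a)); split=> [a|].
    by exists (mpart f a) => //; apply: mhomog_mpart.
  by rewrite -quot_pi_sum -sum_mpart.
- have /choice[g gP] b : exists h, mhomog b h /\ quot_pi I h = f b.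
    by have [h] := fh b; exists h.
  have [ga <-] := gP a; rewrite -quot_pi0; apply/quot_piP; rewrite subr0.
  apply: ideal_supp; first exact: mi_ideal.
  move=> m mg; have ma := ga _ mg.
  apply: (@mi_supp _ (\sum_(b <- s) g b)).
    rewrite -[X in mi_set I X]subr0; apply/quot_piP.
    rewrite quot_pi0 quot_pi_sum -[RHS]fs0; apply: eq_bigr => b _.
    by case: (gP b).
  rewrite mcoeff_msupp mcoeff_mhomog_sum ?ma -?mcoeff_msupp //.
  by move=> b; case: (gP b).
Qed.

Definition quot_module (I : mon_ideal) : mgmodule := MgModule (quot_compP I).

End Multigraded.

Definition mpoly_incl (K : fieldType) (k n : nat) (e : 'I_k -> 'I_n)
    (f : {mpoly K[k]}) : {mpoly K[n]} := f \mPo [tuple 'X_(e i) | i < k].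

Section Extension.
Variables (K : fieldType) (k n : nat) (e : 'I_k -> 'I_n).

Lemma mpoly_inclX m :
  mpoly_incl e 'X_[K, m] = 'X_[(\sum_(i < k) U_(e i) *+ m i)%MM].
Proof.
rewrite /mpoly_incl comp_mpolyX -mprodXnE; apply: eq_bigr => i _.
by rewrite tnth_mktuple.
Qed.

Lemma ext_subproof (I : mon_ideal K k) : exists G : set 'X_{1..n},
  ideal_gen (mpoly_incl e @` I) = ideal_gen [set 'X_[m] | m in G].
Proof.
have [G IG] := mi_gen I.
exists [set (\sum_(i < k) U_(e i) *+ m i)%MM | m in G].
apply/seteqP; split; apply: smallest_sub; try exact: ideal_gen_ideal.
  set A := ideal_gen _; have [A0 AD AM] : is_ideal A by exact: ideal_gen_ideal.
  suff: I `<=` mpoly_incl e @^-1` A by move=> IA _ [f If <-]; apply: IA.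
  rewrite IG; apply: smallest_sub; first split=> /=.
  - by rewrite /mpoly_incl raddf0.
  - by move=> f g Af Ag; rewrite /mpoly_incl raddfD; apply: AD.
  - by move=> a f Af; rewrite /mpoly_incl rmorphM; apply: AM.
  move=> _ [m Gm <-] /=; rewrite mpoly_inclX; apply: sub_gen_smallest.
  by exists (\sum_(i < k) U_(e i) *+ m i)%MM => //; exists m.
move=> _ [_ [m Gm <-] <-]; rewrite -mpoly_inclX; apply: sub_gen_smallest.
by exists 'X_[m] => //; rewrite IG; apply: sub_gen_smallest; exists m.
Qed.

(* The ideal I K[x_1, ..., x_n] generated by the image of I. *)
Definition mi_ext (I : mon_ideal K k) : mon_ideal K n :=
  MonIdeal (ext_subproof I).

End Extension.

(* Ordinals are 0-based: ordinal i is the index of the variable x_(i+1) of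
   K[x_1, ..., x_n], and of x_(s+i) in K[x_s, ..., x_n]. *)
Definition low_var (r n : nat) (rn : (r <= n)%N) : 'I_r -> 'I_n := widen_ord rn.

Fact high_var_subproof (s n : nat) (s1 : (1 <= s)%N) (i : 'I_(n.+1 - s)) :
  (i + s.-1 < n)%N.
Proof.
move: {i}(nat_of_ord i) (ltn_ord i) => i.
by case: s s1 => // s _; rewrite subSS ltn_subRL addnC.
Qed.

Definition high_var (s n : nat) (s1 : (1 <= s)%N) (i : 'I_(n.+1 - s)) : 'I_n :=
  Ordinal (high_var_subproof s1 i).

(* Main.v *)
Require Import Defs.
From mathcomp Require Import all_boot all_order all_algebra.
From mathcomp Require Import mpoly.
From mathcomp Require Import boolp classical_sets constructive_ereal.
From mathcomp Require Import zify.

(** The question is combinatorial. A monomial ideal, and likewise the quotient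
    by one, has the monomials with exponent in some set [A] as a homogeneous
    [K]-basis, with at most one basis element in each degree. A homogeneous
    generator of a Stanley space is therefore a scalar multiple of a monomial
    [x^m], and [x^m K[Z]] is spanned by the monomials with exponent in the cone
    [m + N^Z]. Stanley decompositions are thus the same as finite partitions of
    [A] into cones (the monomial bases [ideal_has_exponents] and
    [quot_has_exponents], the translation [sdepth_ge_le] and
    [sdepth_Noo_or_ge]).

    For such partitions two facts suffice. The intersection of two cones is
    empty or a cone, whose directions are the common ones; so the common
    refinement of a partition of [A] of depth [a] and a partition of [B] of
    depth [b] is a partition of their intersection of depth at least
    [a + b - n] ([sdepth_geI]). Partitions of disjoint sets can be put together
    ([sdepth_geU]). Applied to the exponent sets of [IS] and [JS] and to their
    complements, these give the four inequalities in terms of [n]: the first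
    two concern an intersection, the last two a union, written as the disjoint
    union of one set and of the trace of the other set on the
    complement of the first ([sdepthI], [sdepthU]).

    The equalities come from the invariance [sdepth_ext]: adding variables adds
    their number to the Stanley depth. A partition extends by letting the new
    variables be free in each cone; conversely, the slice of a partition at
    exponent zero in the new variables is a partition that lost at most the new
    directions.

    A Stanley depth other than [-oo] is attained by a decomposition, which is
    then taken as the starting point of these constructions; a depth equal to
    [-oo] makes the bound in which it occurs equal to [-oo]. *)

Set Implicit Arguments.
Unset Strict Implicit.
Unset Printing Implicit Defensive.

Import Order.TTheory GRing.Theory Num.Theory.
Local Open Scope ring_scope.

(** * Tilings of sets of exponents by cones *)

Section Tilings.
Variable n : nat.
Implicit Types (j k m : 'X_{1..n}) (Z : {set 'I_n}).

(** The pair [(m, Z)] stands for the exponents of the monomials in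
    [x^m K[Z]]. *)
Definition cone : Type := 'X_{1..n} * {set 'I_n}.

Definition in_cone k (c : cone) : bool :=
  [forall i, (c.1 i <= k i)%N && ((i \in c.2) || (k i == c.1 i))].

(** Counting cones states covering and disjointness at once, and makes unions
    and intersections of tilings a matter of adding and multiplying counts. *)
Definition tiles (D : seq cone) (A : pred 'X_{1..n}) : Prop :=
  forall k, count (in_cone k) D = A k :> nat.

Definition sdepth_ge (A : pred 'X_{1..n}) (x : \bar int) : Prop :=
  exists2 D, tiles D A & forall c : cone, c \in D -> (x <= (#|c.2|%:Z)%:E)%E.

Lemma in_coneP k (c : cone) :
  reflect (forall i, (c.1 i <= k i)%N /\ (i \notin c.2 -> k i = c.1 i))
          (in_cone k c).
Proof.
apply: (iffP forallP) => kc i; have := kc i.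
  by case/andP=> -> /orP[->|/eqP ->].
by case=> -> /=; case: (i \in c.2) => //= ->.
Qed.

Lemma in_cone_apex m Z : in_cone m (m, Z).
Proof. by apply/in_coneP. Qed.

Lemma in_cone_add m j Z : (forall i, j i != 0%N -> i \in Z) ->
  in_cone (m + j)%MM (m, Z).
Proof.
move=> jZ; apply/in_coneP => i; rewrite mnmDE leq_addr; split=> // iZ /=.
by have [->|/jZ] := eqVneq (j i) 0%N; rewrite ?addn0 ?(negPf iZ).
Qed.

Lemma in_coneD m k Z : in_cone k (m, Z) ->
  exists2 j, k = (m + j)%MM & forall i, j i != 0%N -> i \in Z.
Proof.
move=> /in_coneP kc; exists (k - m)%MM.
  by apply/mnmP => i; rewrite mnmDE mnmBE subnKC //; case: (kc i).
move=> i; rewrite mnmBE; apply: contraR => /(proj2 (kc i)) -> /=.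
by rewrite subnn.
Qed.

Definition cone_meet (c d : cone) : cone :=
  ([multinom maxn (c.1 i) (d.1 i) | i < n], c.2 :&: d.2).

Lemma cone_meetP k (c d : cone) : in_cone k c && in_cone k d =
  [&& in_cone (cone_meet c d).1 c, in_cone (cone_meet c d).1 d
    & in_cone k (cone_meet c d)].
Proof.
apply/idP/idP => [/andP[/in_coneP kc /in_coneP kd]|].
  apply/and3P; split; apply/in_coneP => i /=; rewrite mnmE;
    have [ck kc'] := kc i; have [dk kd'] := kd i.
  - rewrite leq_maxl; split=> // /kc' kci.
    by apply/maxn_idPl; rewrite -kci.
  - rewrite leq_maxr; split=> // /kd' kdi.
    by apply/maxn_idPr; rewrite -kdi.
  - rewrite geq_max ck dk; split=> //; rewrite inE negb_and.
    by case/orP=> [/kc'|/kd'] ki; apply/eqP; rewrite eqn_leq geq_max ck dk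
      andbT ki ?leq_maxl ?leq_maxr.
case/and3P=> /in_coneP mc /in_coneP md /in_coneP km.
apply/andP; split; apply/in_coneP => i;
  have := km i; have := mc i; have := md i; rewrite /= !mnmE geq_max inE.
- move=> _ [_ mci] [/andP[-> _] ki]; split=> // ic.
  by rewrite ki ?mci // negb_and ic.
- move=> [_ mdi] _ [/andP[_ ->] ki]; split=> // id.
  by rewrite ki ?mdi // negb_and id orbT.
Qed.

Lemma card_meet_ge Z Z' : (#|Z| + #|Z'| <= #|Z :&: Z'| + n)%N.
Proof.
rewrite -cardsUI addnC leq_add2l -[X in (_ <= X)%N]card_ord.
exact: max_card.
Qed.

Lemma eq_sdepth_ge (A B : pred 'X_{1..n}) x :
  A =1 B -> sdepth_ge A x -> sdepth_ge B x.
Proof. by move=> AB [D DA Dx]; exists D => // k; rewrite DA AB. Qed.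

(** Two cones meet in the cone with apex the join of the apices and directions
    the common directions, unless that join misses one of them; this loses at
    most [n] directions in total. *)
Lemma sdepth_geI (A B : pred 'X_{1..n}) x y :
  sdepth_ge A x -> sdepth_ge B y ->
  sdepth_ge (predI A B) (x + y - (n%:Z)%:E)%E.
Proof.
move=> [D DA Dx] [E EB Ey].
pose ok (p : cone * cone) :=
  in_cone (cone_meet p.1 p.2).1 p.1 && in_cone (cone_meet p.1 p.2).1 p.2.
exists [seq cone_meet p.1 p.2 | p <- [seq (c, d) | c <- D, d <- E] & ok p].
  move=> k; rewrite count_map count_filter.
  transitivity (count (in_cone k) D * count (in_cone k) E)%N; last first.
    by rewrite DA EB mulnb.
  transitivity (count (fun p : cone * cone => in_cone k p.1 && in_cone k p.2)
    [seq (c, d) | c <- D, d <- E]).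
    by apply: eq_count => p; rewrite /= cone_meetP andbC andbA.
  elim: (D) => //= c D' IH; rewrite count_cat IH count_map mulnDl.
  congr (_ + _)%N.
  rewrite (@eq_count _ _ (fun d => in_cone k c && in_cone k d)) //.
  by case: (in_cone k c); rewrite ?mul1n ?mul0n -?(count_pred0 E).
move=> cd /mapP[p]; rewrite mem_filter => /andP[_ /allpairsP[[c d]]].
case=> cD dE -> ->; rewrite leeBlDr //.
apply: (le_trans (leeD (Dx _ cD) (Ey _ dE))).
by rewrite -!EFinD lee_fin -!PoszD lez_nat card_meet_ge.
Qed.

Lemma sdepth_geU (A B : pred 'X_{1..n}) x y : (forall k, A k -> ~~ B k) ->
  sdepth_ge A x -> sdepth_ge B y -> sdepth_ge (predU A B) (mine x y).
Proof.
move=> AB [D DA Dx] [E EB Ey]; exists (D ++ E).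
  move=> k; rewrite count_cat DA EB /=; have := AB k.
  by case: (A k) => [/(_ isT)/negPf ->|_]; case: (B k).
move=> c; rewrite mem_cat ge_min => /orP[/Dx -> //|/Ey ->].
by rewrite orbT.
Qed.

End Tilings.

(** * Extending the set of variables *)

Section Variables.
Variables (k n : nat) (e : 'I_k -> 'I_n).
Hypothesis e_inj : injective e.
Implicit Types (m : 'X_{1..k}) (q : 'X_{1..n}).

Definition mnm_ext m : 'X_{1..n} := (\sum_(i < k) U_(e i) *+ m i)%MM.

Definition mnm_res q : 'X_{1..k} := [multinom q (e i) | i < k].

Lemma mnm_extE m i : mnm_ext m (e i) = m i.
Proof.
rewrite /mnm_ext mnm_sumE (bigD1 i) //= mulmnE mnm1E eqxx mul1n.
rewrite big1 ?addn0 // => j ji.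
by rewrite mulmnE mnm1E (inj_eq e_inj) (negPf ji).
Qed.

Lemma mnm_ext_out m j : j \notin codom e -> mnm_ext m j = 0%N.
Proof.
move=> je; rewrite /mnm_ext mnm_sumE big1 // => i _.
rewrite mulmnE mnm1E; case: eqP => // ij; case/negP: je.
by rewrite -ij codom_f.
Qed.

Lemma mnm_extK : cancel mnm_ext mnm_res.
Proof. by move=> m; apply/mnmP => i; rewrite mnmE mnm_extE. Qed.

Lemma mnm_ext_res_le q : (mnm_ext (mnm_res q) <= q)%MM.
Proof.
apply/mnm_lepP => j; have [/codomP[i ->]|je] := boolP (j \in codom e).
  by rewrite mnm_extE mnmE.
by rewrite mnm_ext_out.
Qed.

Lemma mnm_resD q q' : mnm_res (q + q')%MM = (mnm_res q + mnm_res q')%MM.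
Proof. by apply/mnmP => i; rewrite mnmDE !mnmE. Qed.

Definition cone_ext (c : cone k) : cone n :=
  (mnm_ext c.1, e @: c.2 :|: [set j | j \notin codom e]).

Lemma in_cone_ext q c : in_cone q (cone_ext c) = in_cone (mnm_res q) c.
Proof.
apply/in_coneP/in_coneP => qc i.
  have := qc (e i); rewrite /= mnm_extE mnmE !inE codom_f orbF.
  by rewrite mem_imset.
rewrite /= !inE; have [/codomP[i' ->]|ie] := boolP (i \in codom e).
  by have := qc i'; rewrite mnm_extE mnmE orbF mem_imset.
by rewrite mnm_ext_out // orbT.
Qed.

Lemma card_codom_compl : (#|[set j | j \notin codom e]| + k = n)%N.
Proof.
rewrite -[k in (_ + k)%N]card_ord -(card_codom e_inj) addnC -[RHS]card_ord.
rewrite -[in LHS]cardsE -(cardsC [set j | j \in codom e]).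
by congr (_ + _)%N; apply: eq_card => j; rewrite !inE.
Qed.

Lemma card_cone_ext c : (#|(cone_ext c).2| + k = #|c.2| + n)%N.
Proof.
rewrite /= cardsU (_ : _ :&: _ = finset.set0) ?cards0 ?subn0; last first.
  apply/setP => j; rewrite !inE; apply/andP=> -[/imsetP[i _ ->]].
  by rewrite codom_f.
by rewrite card_imset // -addnA card_codom_compl.
Qed.

(** Every new variable becomes a direction of every cone. *)
Lemma sdepth_ge_ext (A : pred 'X_{1..k}) x : sdepth_ge A x ->
  sdepth_ge (A \o mnm_res) (x + ((n%:Z)%:E - (k%:Z)%:E))%E.
Proof.
move=> [D DA Dx]; exists (map cone_ext D).
  move=> q; rewrite count_map -DA; apply: eq_count => c /=.
  exact: in_cone_ext.
move=> d /mapP[c cD ->]; rewrite addeA leeBlDr // -!EFinD -PoszD card_cone_ext.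
by rewrite PoszD EFinD leeD2r // Dx.
Qed.

(** The exponents with support in the old variables form a section of
    [mnm_res]; slicing a tiling along it keeps exactly the cones whose apex lies
    on the section. *)
Lemma sdepth_ge_res (A : pred 'X_{1..k}) x : sdepth_ge (A \o mnm_res) x ->
  sdepth_ge A (x - ((n%:Z)%:E - (k%:Z)%:E))%E.
Proof.
move=> [D DA Dx].
pose on (c : cone n) := c.1 == mnm_ext (mnm_res c.1).
pose res (c : cone n) : cone k := (mnm_res c.1, e @^-1: c.2).
exists [seq res c | c <- D & on c].
  move=> m; rewrite count_map count_filter.
  transitivity (count (in_cone (mnm_ext m)) D); last by rewrite DA /= mnm_extK.
  apply: eq_count => c /=; apply/andP/in_coneP => [[/in_coneP mc /eqP oc] j|mc].
    have [/codomP[i ->]|je] := boolP (j \in codom e).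
      by have := mc i; rewrite /= mnm_extE mnmE !inE.
    by rewrite oc !mnm_ext_out.
  split; first by apply/in_coneP => i; have := mc (e i);
    rewrite /= mnm_extE mnmE !inE.
  apply/eqP/mnmP => j; have [/codomP[i ->]|je] := boolP (j \in codom e).
    by rewrite mnm_extE mnmE.
  have [+ _] := mc j; rewrite !mnm_ext_out // leqn0.
  by move/eqP.
move=> d /mapP[c]; rewrite mem_filter => /andP[_ cD] ->.
rewrite leeBlDr //; apply: le_trans (Dx _ cD) _.
rewrite addeA leeBrDr // -!EFinD lee_fin -!PoszD lez_nat.
rewrite -[X in (_ <= _ + X)%N]card_codom_compl addnA leq_add2r.
rewrite -(card_imset _ e_inj); apply: leq_trans (leq_card_setU _ _).
apply/subset_leq_card/fintype.subsetP => j jc; rewrite !inE.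
have [/codomP[i ji]|//] := boolP (j \in codom e); last by rewrite orbT.
by rewrite ji orbF mem_imset // inE -ji.
Qed.

End Variables.

(** * Stanley decompositions as tilings *)

Section MaximalDecomposition.
Variables (K : fieldType) (n : nat) (M : mgmodule K n).

Lemma sdepth_dec_val (D : stanley_dec M) : sdepth_dec D = +oo%E \/
  exists2 d : nat, (d <= n)%N & sdepth_dec D = (d%:Z)%:E%E.
Proof.
rewrite /sdepth_dec; elim/big_ind: _ => [|x y hx hy|i _]; first by left.
  by rewrite minEle; case: ifP.
by right; exists #|sd_vars i|; rewrite // -[X in (_ <= X)%N]card_ord max_card.
Qed.

(** The decompositions have only finitely many possible depths, so the maximum
    is attained as soon as there is a decomposition. *)
Lemma sdepth_attained (D0 : stanley_dec M) :
  (exists D : stanley_dec M, sdepth_dec D = sdepth M) /\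
  forall D : stanley_dec M, (sdepth_dec D <= sdepth M)%E.
Proof.
apply: (@xgetPex _ -oo%E (fun d => (exists D : stanley_dec M, sdepth_dec D = d)
  /\ forall D : stanley_dec M, (sdepth_dec D <= d)%E)).
have [[D Doo]|noo] := pselect (exists D : stanley_dec M, sdepth_dec D = +oo%E).
  by exists +oo%E; split; [exists D|move=> D'; rewrite leey].
pose P d := `[< exists D : stanley_dec M, sdepth_dec D = (d%:Z)%:E%E >].
have fin (D : stanley_dec M) : exists2 d : nat, (d <= n)%N &
    sdepth_dec D = (d%:Z)%:E%E.
  by case: (sdepth_dec_val D) => // Doo; case: noo; exists D.
have [|d|d /asboolP[D Dd] dmax] := @ex_maxnP P n.
- by have [d _ Dd] := fin D0; exists d; apply/asboolP; exists D0.
- move=> /asboolP[D Dd]; have [d' d'n Dd'] := fin D.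
  by move: Dd; rewrite Dd' => -[<-].
exists (d%:Z)%:E%E; split; first by exists D.
move=> D'; have [d' _ D'd'] := fin D'; rewrite D'd' lee_fin lez_nat.
by apply: dmax; apply/asboolP; exists D'.
Qed.

Lemma sdepth_dec_le (D : stanley_dec M) : (sdepth_dec D <= sdepth M)%E.
Proof. by case: (sdepth_attained D). Qed.

Lemma sdepth_Noo_or_max :
  sdepth M = -oo%E \/ exists D : stanley_dec M, sdepth_dec D = sdepth M.
Proof.
have [[D]|noD] := pselect (exists D : stanley_dec M, True).
  by right; case: (sdepth_attained D).
by left; apply: xgetPN => d [[D _] _]; case: noD; exists D.
Qed.

End MaximalDecomposition.

(** What an ideal [I] (with [A] the exponents of the monomials in [I]) and a
    quotient [R/I] (with [A] the exponents of the other monomials) have in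
    common: the [v m] with [m] in [A] are a homogeneous [K]-basis, of which
    [cf x k] are the coordinates, and a polynomial acts on it as on monomials,
    with the exponents outside [A] discarded. *)
Record monomial_basis (K : fieldType) (n : nat) (M : mgmodule K n)
    (A : pred 'X_{1..n}) (v : 'X_{1..n} -> M) (cf : M -> 'X_{1..n} -> K) :
    Prop := MonomialBasis {
  mb_add : forall k x y, cf (x + y) k = cf x k + cf y k;
  mb_inj : forall x, (forall k, cf x k = 0) -> x = 0;
  mb_scale : forall f m k, A m -> cf (f *: v m) k = (f * 'X_[m])@_k *+ A k;
  mb_supp : forall x, exists s : seq 'X_{1..n},
    forall k, cf x k != 0 -> (k \in s) && A k;
  mb_homog : forall m, mg_comp (zexp m) (v m);
  mb_comp : forall a x k, mg_comp a x -> cf x k != 0 -> zexp k = a }.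

Lemma count_tnth (T : Type) (p : pred T) (s : seq T) :
  count p s = (\sum_(i < size s) p (tnth (in_tuple s) i))%N.
Proof.
rewrite -sum1_count big_mkcond big_tnth.
by apply: eq_bigr => i _; case: (p _).
Qed.

Section Bridge.
Variables (K : fieldType) (n : nat) (M : mgmodule K n) (A : pred 'X_{1..n}).
Variables (v : 'X_{1..n} -> M) (cf : M -> 'X_{1..n} -> K).
Hypothesis bM : monomial_basis A v cf.

Lemma cf0 k : cf 0 k = 0.
Proof.
by apply: (addIr (cf 0 k)); rewrite add0r -(mb_add bM) addr0.
Qed.

Lemma cfB x y k : cf (x - y) k = cf x k - cf y k.
Proof. by apply/eqP; rewrite eq_sym subr_eq -(mb_add bM) subrK. Qed.

Lemma cf_sum (T : Type) (s : seq T) (F : T -> M) k :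
  cf (\sum_(i <- s) F i) k = \sum_(i <- s) cf (F i) k.
Proof. by apply: (big_morph (cf^~ k) (mb_add bM k) (cf0 k)). Qed.

Lemma cf_eq x y : (forall k, cf x k = cf y k) -> x = y.
Proof.
move=> xy; apply/eqP; rewrite -subr_eq0; apply/eqP/(mb_inj bM) => k.
by rewrite cfB xy subrr.
Qed.

Lemma cf_v m k : A m -> cf (v m) k = (m == k)%:R.
Proof.
move=> Am; rewrite -[v m]scale1r (mb_scale bM) // mul1r mcoeffX.
by case: eqP => [<-|_]; rewrite ?Am ?mul0rn.
Qed.

Lemma cf_scaleX c j m k : A m ->
  cf ((c *: 'X_[j]) *: v m) k = (c *+ (m + j == k)%MM) *+ A k.
Proof.
move=> Am; rewrite (mb_scale bM) // -scalerAl mcoeffZ -mpolyXD mcoeffX.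
by rewrite mulr_natr addmC.
Qed.

Lemma polyKX (j : 'X_{1..n}) (c : K) (Z : {set 'I_n}) :
  (forall i, j i != 0%N -> i \in Z) -> polyK Z (c *: 'X_[j]).
Proof. by move=> jZ m /msuppZ_le /mem_msuppXP <-. Qed.

Lemma cf_stanley_space m Z f k : A m -> polyK Z f ->
  cf (f *: v m) k != 0 -> in_cone k (m, Z).
Proof.
move=> Am fZ; rewrite (mb_scale bM) //; case: (A k); last first.
  by rewrite mulr0n eqxx.
rewrite mulr1n -mcoeff_msupp => /msuppM_le /allpairsP[[j m'] /=].
by case=> jf /mem_msuppXP <- ->; rewrite addmC; apply/in_cone_add/fZ.
Qed.

(** Distinct exponents have distinct degrees, so a degree component is spanned
    by at most one basis element. *)
Lemma homog_monomial a x : mg_comp a x -> x != 0 ->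
  exists2 m, A m & exists2 c : K, c != 0 & x = c%:MP *: v m.
Proof.
move=> ax /eqP x0.
have [m cm] : exists m, cf x m != 0.
  apply: contrapT => xm; apply/x0/(mb_inj bM) => m.
  by apply: contrapT => /eqP cm; apply: xm; exists m.
have [s /(_ _ cm) /andP[_ Am]] := mb_supp bM x.
exists m => //; exists (cf x m) => //; apply: cf_eq => k.
rewrite -[_%:MP]mulr1 -mpolyX0 mul_mpolyC cf_scaleX // addm0.
have [<-|mk] := eqVneq m k; first by rewrite Am.
rewrite mul0rn; apply/eqP; apply: contraNT mk => ck.
by rewrite -(inj_eq (@zexp_inj n)) (mb_comp bM ax cm) (mb_comp bM ax ck).
Qed.

Section DecOfTiling.
Variable D : seq (cone n).
Hypothesis DA : tiles D A.
Let c i := tnth (in_tuple D) i.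

Let cA i k : in_cone k (c i) -> A k.
Proof.
move=> ki; have := DA k; rewrite count_tnth (bigD1 i) //= ki.
by case: (A k).
Qed.

Let cAm i : A (c i).1.
Proof. by apply: (@cA i); case: (c i) => m Z; apply: in_cone_apex. Qed.

Let c_inj k i i' : in_cone k (c i) -> in_cone k (c i') -> i = i'.
Proof.
move=> ki ki'; apply/eqP; apply: contraT => ii'; have := DA k.
rewrite count_tnth (bigD1 i) //= ki (bigD1 i') /= 1?eq_sym // ki'.
by case: (A k).
Qed.

Let cf_out i f k : polyK (c i).2 f -> ~~ in_cone k (c i) ->
  cf (f *: v (c i).1) k = 0.
Proof.
move=> fZ; apply: contraNeq => /(cf_stanley_space (cAm i) fZ).
by case: (c i).
Qed.

Lemma tiling_free i f : polyK (c i).2 f -> f *: v (c i).1 = 0 -> f = 0.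
Proof.
move=> fZ f0; apply/mpolyP => j; rewrite mcoeff0; apply/eqP.
apply: contraT => fj; have jZ := fZ j; rewrite mcoeff_msupp in jZ.
have ki : in_cone ((c i).1 + j)%MM (c i).
  by have := in_cone_add (c i).1 (jZ fj); case: (c i).
have := cf0 ((c i).1 + j)%MM.
by rewrite -f0 (mb_scale bM) // mcoeffMX (cA ki) => /eqP; rewrite (negPf fj).
Qed.

(** The component of [x] in a Stanley space collects the terms of [x] with
    exponent in the cone. *)
Lemma tiling_span x : exists y : 'I_(size D) -> M,
  (forall i, stanley_space (v (c i).1) (c i).2 (y i)) /\ x = \sum_i y i.
Proof.
have [s0 s0P] := mb_supp bM x; pose s := undup s0.
have {}s0P k : cf x k != 0 -> (k \in s) && A k by rewrite mem_undup; apply: s0P.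
pose f i := \sum_(k <- s | in_cone k (c i)) cf x k *: 'X_[(k - (c i).1)%MM].
have fZ i : polyK (c i).2 (f i).
  move=> j; rewrite mcoeff_msupp /f raddf_sum => fj.
  have [k ki kj] : exists2 k, in_cone k (c i) & (k - (c i).1)%MM = j.
    apply: contrapT => nk; case/eqP: fj; rewrite big1 // => k ki.
    rewrite /= mcoeffZ mcoeffX; case: eqP => [kj|]; last by rewrite mulr0.
    by case: nk; exists k.
  have [|j' kE jZ] := @in_coneD _ (c i).1 k (c i).2; first by case: (c i) ki.
  by rewrite -kj kE [(_ + j')%MM]addmC addmK.
have cfE i k : cf (f i *: v (c i).1) k = cf x k *+ in_cone k (c i).
  have [ki|ki] := boolP (in_cone k (c i)); last first.
    by rewrite cf_out.
  rewrite (mb_scale bM) // /f mulr_suml raddf_sum (cA ki) mulr1n.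
  under eq_bigr => k' k'i.
    have [|j' kE _] := @in_coneD _ (c i).1 k' (c i).2; first by case: (c i) k'i.
    rewrite /= -scalerAl mcoeffZ -mpolyXD kE [(_ + j')%MM]addmC addmK addmC -kE.
    rewrite mcoeffX mulr_natr; over.
  have [ks|ks] := boolP (k \in s).
    rewrite big_mkcond (bigD1_seq k) ?undup_uniq //= ki eqxx big1 ?addr0 //.
    by move=> k' /negPf ->; case: ifP.
  rewrite big_seq_cond big1 => [|k' /andP[k's _]].
    by apply/esym/eqP; apply: contraNT ks => /s0P /andP[].
  by case: eqP => // kk; rewrite -kk k's in ks.
exists (fun i => f i *: v (c i).1); split=> [i|]; first by exists (f i).
apply: cf_eq => k; rewrite cf_sum; under eq_bigr do rewrite cfE.
rewrite sumrMnr -(count_tnth (in_cone k)) DA.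
case: (A k) (s0P k) => //; case: eqP => [->|_ /(_ isT)].
  by rewrite mul0rn.
by rewrite andbF.
Qed.

Lemma tiling_direct (y : 'I_(size D) -> M) :
  (forall i, stanley_space (v (c i).1) (c i).2 (y i)) ->
  \sum_i y i = 0 -> forall i, y i = 0.
Proof.
move=> yZ y0 i; apply: (mb_inj bM) => k.
have out i' : ~~ in_cone k (c i') -> cf (y i') k = 0.
  by have [f fZ <-] := yZ i'; apply: cf_out.
have [ki|] := boolP (in_cone k (c i)); last exact: out.
rewrite -[RHS](cf0 k) -y0 cf_sum (bigD1 i) //= big1 ?addr0 // => i' i'i.
by apply: out; apply: contraNN i'i => /(c_inj ki) ->.
Qed.

Lemma tiling_homog i : exists a, mg_comp a (v (c i).1).
Proof. by exists (zexp (c i).1); apply: mb_homog bM _. Qed.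

Definition dec_of_tiling : stanley_dec M :=
  StanleyDec tiling_homog tiling_free tiling_span tiling_direct.

End DecOfTiling.

Lemma sdepth_ge_le x : sdepth_ge A x -> (x <= sdepth M)%E.
Proof.
move=> [D DA Dx]; apply: le_trans (sdepth_dec_le (dec_of_tiling DA)).
apply/bigmin_geP; split=> [|i _]; first exact: leey.
by apply: Dx; apply: mem_tnth.
Qed.

Lemma dec_apex (D : stanley_dec M) i : exists p : 'X_{1..n} * K,
  [/\ A p.1, p.2 != 0 & sd_gen (s := D) i = p.2%:MP *: v p.1].
Proof.
have [a ai] := sd_homog i.
have [|m Am [c c0 uE]] := homog_monomial ai; last by exists (m, c).
apply/eqP => u0; have := @sd_free K n M D i 1; rewrite scale1r u0 => free1.
suff /eqP : 1 = 0 :> {mpoly K[n]} by rewrite oner_eq0.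
by apply: free1 => // m; rewrite msupp1 inE => /eqP -> j; rewrite mnm0E.
Qed.

Lemma cf_X j m k : A m -> cf ('X_[j] *: v m) k = ((m + j == k)%MM && A k)%:R.
Proof.
by move=> Am; rewrite -['X_[j]]scale1r cf_scaleX //; case: (A k); case: eqP.
Qed.

Section TilingOfDec.
Variables (D : stanley_dec M) (p : 'I_(sd_size D) -> 'X_{1..n} * K).
Hypothesis pP : forall i,
  [/\ A (p i).1, (p i).2 != 0 & sd_gen i = (p i).2%:MP *: v (p i).1].
Let c i : cone n := ((p i).1, sd_vars i).

Let dec_cone i k : in_cone k (c i) ->
  A k /\ stanley_space (sd_gen i) (sd_vars i) (v k).
Proof.
have [Am c0 uE] := pP i; move=> /in_coneD[j kE jZ].
have fZ := polyKX (c := (p i).2^-1) jZ.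
have fE : ((p i).2^-1 *: 'X_[j]) *: sd_gen i = 'X_[j] *: v (p i).1.
  rewrite uE scalerA -scalerAl mulrC mul_mpolyC scalerA mulVf //.
  by rewrite scale1r.
have Ak : A k.
  apply: contraT => nAk.
  have /(sd_free fZ) /eqP : ((p i).2^-1 *: 'X_[j]) *: sd_gen i = 0.
    rewrite fE; apply: (mb_inj bM) => k'; rewrite cf_X // -kE.
    by case: eqP => // <-; rewrite (negPf nAk).
  by rewrite scaler_eq0 invr_eq0 (negPf c0) -msupp_eq0 msuppX.
split=> //; exists ((p i).2^-1 *: 'X_[j]) => //.
by rewrite fE; apply: cf_eq => k'; rewrite cf_X // cf_v // -kE;
  case: eqP => // <-; rewrite Ak.
Qed.

(** A common exponent of two cones would place [v k] in two summands of a direct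
    sum: the family with entries [v k] and [- v k] there sums to zero. *)
Let dec_disjoint i i' k : in_cone k (c i) -> in_cone k (c i') -> i = i'.
Proof.
move=> /dec_cone[Ak [f fZ fE]] /dec_cone[_ [f' fZ' fE']].
apply/eqP; apply: contraT => ii'.
pose y l := if l == i then v k else if l == i' then - v k else 0.
have /(_ i) : forall l, y l = 0.
  apply: (@sd_direct _ _ _ D y) => [l|].
    rewrite /y; case: eqP => [->|_]; first by exists f.
    case: eqP => [->|_]; last first.
      by exists 0; rewrite ?scale0r // => m; rewrite msupp0.
    exists (- f'); last by rewrite scaleNr fE'.
    by move=> m; rewrite (perm_mem (msuppN _)); apply: fZ'.
  rewrite (bigD1 i) //= (bigD1 i') 1?eq_sym //= big1 => [|l /andP[li li']].
    by rewrite /y eqxx eq_sym (negPf ii') eqxx addr0 subrr.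
  by rewrite /y (negPf li) (negPf li').
rewrite /y eqxx => /(congr1 (cf^~ k)); rewrite cf_v // cf0 eqxx.
by move/eqP; rewrite oner_eq0.
Qed.

Let dec_cover k : A k -> exists i, in_cone k (c i).
Proof.
move=> Ak; have [y [yZ vE]] := sd_span D (v k).
have [i yi] : exists i, cf (y i) k != 0.
  apply: contrapT => y0; have /eqP := cf_v k Ak.
  rewrite eqxx vE cf_sum big1 ?(eq_sym 0) ?oner_eq0 // => i _.
  by apply: contrapT => /eqP yi; apply: y0; exists i.
exists i; have [Am c0 uE] := pP i; have [f fZ fE] := yZ i.
move: yi; rewrite -fE uE scalerA; apply: cf_stanley_space => // m.
by rewrite mulrC mul_mpolyC => /msuppZ_le/fZ.
Qed.

Lemma tiling_of_dec : sdepth_ge A (sdepth_dec D).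
Proof.
exists (map c (enum 'I_(sd_size D))) => [k|d /mapP[i _ ->]]; last first.
  exact: bigmin_le.
rewrite count_map -sum1_count big_mkcond big_enum /=.
have [Ak|nAk] := boolP (A k).
  have [i ki] := dec_cover Ak.
  rewrite (bigD1 i) //= ki big1 ?addn0 // => i' i'i.
  by case: ifP => // /(dec_disjoint ki) ii'; rewrite ii' eqxx in i'i.
by apply: big1 => i _; case: ifP => // /dec_cone[]; rewrite (negPf nAk).
Qed.

End TilingOfDec.

Lemma sdepth_Noo_or_ge : sdepth M = -oo%E \/ sdepth_ge A (sdepth M).
Proof.
have [->|[D <-]] := sdepth_Noo_or_max M; first by left.
by right; have /choice[p pP] := @dec_apex D; apply: (tiling_of_dec pP).
Qed.

End Bridge.

(** * Stanley depth of modules with a monomial basis *)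

Definition has_exponents (K : fieldType) (n : nat) (M : mgmodule K n)
    (A : pred 'X_{1..n}) : Prop := exists v cf, @monomial_basis K n M A v cf.

Section StanleyDepth.
Variables (K : fieldType) (n : nat).
Implicit Types M N P : mgmodule K n.

Lemma sdepthI M N P A B C : has_exponents M A -> has_exponents N B ->
  has_exponents P C -> (forall k, C k = A k && B k) ->
  (sdepth M + sdepth N - (n%:Z)%:E <= sdepth P)%E.
Proof.
move=> [? [? bM]] [? [? bN]] [? [? bP]] CE.
have [->|geA] := sdepth_Noo_or_ge bM; first by rewrite leNye.
have [->|geB] := sdepth_Noo_or_ge bN; first by rewrite addeNy leNye.
apply: (sdepth_ge_le bP); apply: eq_sdepth_ge (sdepth_geI geA geB).
by move=> k; rewrite CE.
Qed.

(** [A] and [B] have as union the disjoint union of [A] and of the trace of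
    [B] on the complement of [A]. *)
Lemma sdepthU M M' N P A A' B C : has_exponents M A -> has_exponents M' A' ->
  has_exponents N B -> has_exponents P C ->
  (forall k, A' k = ~~ A k) -> (forall k, C k = A k || B k) ->
  (mine (sdepth M) (sdepth N + sdepth M' - (n%:Z)%:E) <= sdepth P)%E.
Proof.
move=> [? [? bM]] [? [? bM']] [? [? bN]] [? [? bP]] A'E CE.
have [->|geA] := sdepth_Noo_or_ge bM; first by rewrite ge_min leNye.
have [->|geA'] := sdepth_Noo_or_ge bM'.
  by rewrite addeNy ge_min leNye orbT.
have [->|geB] := sdepth_Noo_or_ge bN; first by rewrite ge_min leNye orbT.
apply: (sdepth_ge_le bP).
apply: eq_sdepth_ge (sdepth_geU _ geA (sdepth_geI geB geA')) => k /=.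
  by rewrite CE A'E; case: (A k); case: (B k).
by rewrite A'E => ->; rewrite andbF.
Qed.

End StanleyDepth.

Lemma sdepth_ext (K : fieldType) (k n : nat) (e : 'I_k -> 'I_n)
    (M : mgmodule K k) (N : mgmodule K n) A B :
  injective e -> has_exponents M A -> has_exponents N B ->
  (forall q, B q = A (mnm_res e q)) ->
  sdepth N = (sdepth M + ((n%:Z)%:E - (k%:Z)%:E))%E.
Proof.
move=> ei [? [? bM]] [? [? bN]] BE; apply/eqP; rewrite eq_le; apply/andP; split.
  have [->|geB] := sdepth_Noo_or_ge bN; first by rewrite leNye.
  rewrite -leeBlDr //; apply: (sdepth_ge_le bM); apply: (sdepth_ge_res ei).
  exact: eq_sdepth_ge geB.
have [->|geA] := sdepth_Noo_or_ge bM; first by rewrite leNye.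
apply: (sdepth_ge_le bN); apply: eq_sdepth_ge (sdepth_ge_ext ei geA) => q.
by rewrite BE.
Qed.

(** * Monomial ideals and their quotients *)

Section MonomialIdeals.
Variables (K : fieldType) (n : nat).
Implicit Types I J : mon_ideal K n.

Definition ideal_exp I : pred 'X_{1..n} := fun m => `[< mi_set I 'X_[m] >].

Lemma mcoeff_ideal0 I f m : mi_set I f -> ~~ ideal_exp I m -> f@_m = 0.
Proof.
move=> If; apply: contraNeq; rewrite -mcoeff_msupp => mf.
exact/asboolP/(mi_supp If).
Qed.

Lemma ideal_has_exponents I : has_exponents (ideal_module I) (ideal_exp I).
Proof.
exists (fun m => insubd (0 : ideal_sort I) ('X_[m] : {mpoly K[n]}^o)).
exists (fun x m => (val (x : ideal_sort I))@_m); split.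
- by move=> k x y; rewrite mcoeffD.
- by move=> x x0; apply: val_inj; apply/mpolyP => k; rewrite x0 mcoeff0.
- move=> f m k Im.
  have -> : val (f *: insubd (0 : ideal_sort I) ('X_[m] : {mpoly K[n]}^o))
      = f * 'X_[m] by rewrite /= insubdK.
  have [_|nIk] := boolP (ideal_exp I k); rewrite ?mulr1n // mulr0n.
  apply: (mcoeff_ideal0 _ nIk); case: (mi_ideal I) => _ _; apply.
  exact/asboolP.
- move=> x; exists (msupp (val (x : ideal_sort I))) => k.
  rewrite -mcoeff_msupp => kx; rewrite kx; apply/asboolP/(mi_supp _ kx).
  exact/asboolP/(valP x).
- move=> m k; rewrite val_insubd; case: ifP => _; last exact: mhomog0.
  by move=> /mem_msuppXP <-.
- by move=> a x k xa; rewrite -mcoeff_msupp => /xa.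
Qed.

Lemma quot_has_exponents I :
  has_exponents (quot_module I) (predC (ideal_exp I)).
Proof.
(* [repr] is an arbitrary representative, whose coefficients are determined by
   the class only at the exponents outside [I]. *)
pose cf (x : quot_sort I) k := (repr x : {mpoly K[n]})@_k *+ ~~ ideal_exp I k.
have cfE f k : cf (quot_pi I f) k = f@_k *+ ~~ ideal_exp I k.
  rewrite /cf; have [//|nIk] := boolP (ideal_exp I k); rewrite !mulr1n.
  apply/eqP; rewrite -subr_eq0 -mcoeffB; apply/eqP/(mcoeff_ideal0 _ nIk).
  by apply/quot_piP; rewrite /quot_pi reprK.
exists (fun m => quot_pi I 'X_[m]), cf; split.
- move=> k x y; have [f ->] := quot_pi_surj x; have [g ->] := quot_pi_surj y.
  by rewrite -quot_piD !cfE mcoeffD mulrnDl.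
- move=> x x0; have [f xE] := quot_pi_surj x.
  rewrite xE -quot_pi0; apply/quot_piP; rewrite subr0.
  apply: (ideal_supp (mi_ideal I)) => m mf.
  apply: contrapT => /asboolPn nIm; have := x0 m; rewrite xE cfE.
  by rewrite nIm mulr1n => /eqP; rewrite mcoeff_eq0 mf.
- by move=> f m k _; rewrite [f *: _]quot_scaleE cfE.
- move=> x; exists (msupp (repr x : {mpoly K[n]})) => k.
  rewrite mcoeff_msupp /cf /=; case: (ideal_exp I k).
    by rewrite mulr0n eqxx.
  by rewrite mulr1n andbT.
- by move=> m; exists 'X_[m] => // k /mem_msuppXP <-.
- move=> a _ k [f fa <-]; rewrite cfE => fk; apply: fa; rewrite mcoeff_msupp.
  by apply: contraNneq fk => ->; rewrite mul0rn.
Qed.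

Lemma ideal_exp_cap I J m :
  ideal_exp (mi_cap I J) m = ideal_exp I m && ideal_exp J m.
Proof.
apply/asboolP/andP => [[? ?]|[/asboolP ? /asboolP ?]]; last by split.
by split; apply/asboolP.
Qed.

Lemma ideal_exp_add I J m :
  ideal_exp (mi_add I J) m = ideal_exp I m || ideal_exp J m.
Proof.
apply/asboolP/orP => [[f If [g Jg fgE]]|].
  have : m \in msupp (f + g) by rewrite fgE msuppX inE.
  move=> /msuppD_le; rewrite mem_cat => /orP[mf|mg]; [left|right].
    exact/asboolP/(mi_supp If).
  exact/asboolP/(mi_supp Jg).
have [I0 _ _] := mi_ideal I; have [J0 _ _] := mi_ideal J.
case=> /asboolP mE.
  by exists 'X_[m] => //; exists 0 => //; rewrite addr0.
by exists 0 => //; exists 'X_[m] => //; rewrite add0r.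
Qed.

End MonomialIdeals.

(** Whether a monomial lies in the extension depends only on its exponents of
    the old variables, because the polynomials whose monomials all have their
    old part in [I] form an ideal that contains the image of [I]. *)
Lemma ideal_exp_ext (K : fieldType) (k n : nat) (e : 'I_k -> 'I_n)
    (I : mon_ideal K k) q : injective e ->
  ideal_exp (mi_ext e I) q = ideal_exp I (mnm_res e q).
Proof.
move=> ei; have [I0 ID IM] := mi_ideal I.
apply/asboolP/asboolP => /= [|Iq]; last first.
  have [_ _ EM] := ideal_gen_ideal (mpoly_incl e @` I)%classic.
  rewrite -(submK (mnm_ext_res_le ei q)) mpolyXD; apply: EM.
  rewrite -mpoly_inclX; apply: sub_gen_smallest.
  by exists 'X_[mnm_res e q].
pose E : set {mpoly K[n]} :=
  [set f | forall m, m \in msupp f -> mi_set I 'X_[mnm_res e m]]%classic.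
suff EI : (ideal_gen (mpoly_incl e @` I) `<=` E)%classic.
  by move=> /EI /(_ q); rewrite msuppX inE eqxx; apply.
apply: smallest_sub; first split=> /=.
- by move=> m; rewrite msupp0.
- by move=> f g fE gE m /msuppD_le; rewrite mem_cat => /orP[/fE|/gE].
- move=> a f fE m /msuppM_le /allpairsP[[j1 j2] /= [_ /fE Ij2 ->]].
  by rewrite mnm_resD mpolyXD; apply: IM.
move=> _ [f If <-] m; rewrite [f]mpolyE /mpoly_incl raddf_sum.
move=> /msupp_sum_le /flattenP[s /mapP[j]]; rewrite mem_filter => jf ->.
rewrite /= comp_mpolyZ -/(mpoly_incl e 'X_[j]) mpoly_inclX.
move=> /msuppZ_le/mem_msuppXP <-.
by rewrite mnm_extK //; apply: mi_supp If jf.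
Qed.

(** * Bounds for intersections and sums *)

Lemma low_var_inj r n (rn : (r <= n)%N) : injective (low_var rn).
Proof. by move=> i j /(congr1 val) ij; apply: val_inj. Qed.

Lemma high_var_inj s n (s1 : (1 <= s)%N) : injective (@high_var s n s1).
Proof.
by move=> i j /(congr1 val) /= /addIn ij; apply: val_inj.
Qed.

Lemma sdepth_ext_ideal (K : fieldType) (k n : nat) (e : 'I_k -> 'I_n)
    (I : mon_ideal K k) : injective e ->
  sdepth (ideal_module (mi_ext e I)) =
    (sdepth (ideal_module I) + ((n%:Z)%:E - (k%:Z)%:E))%E.
Proof.
move=> ei.
apply: (sdepth_ext ei (ideal_has_exponents _) (ideal_has_exponents _)) => q.
exact: ideal_exp_ext.
Qed.

Lemma sdepth_ext_quot (K : fieldType) (k n : nat) (e : 'I_k -> 'I_n)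
    (I : mon_ideal K k) : injective e ->
  sdepth (quot_module (mi_ext e I)) =
    (sdepth (quot_module I) + ((n%:Z)%:E - (k%:Z)%:E))%E.
Proof.
move=> ei.
apply: (sdepth_ext ei (quot_has_exponents _) (quot_has_exponents _)) => q.
by rewrite /= ideal_exp_ext.
Qed.

(** The new variables of the two extensions number [n - r] and [s - 1], and
    [n - (n - r) - (s - 1) = r + 1 - s]. *)
Lemma sdepth_shift (n r s : nat) (x y : \bar int) :
  (1 <= s)%N -> (s <= r.+1)%N -> (r.+1 <= n)%N ->
  (x + y - ((r.+1 - s)%N%:Z)%:E =
   (x + ((n%:Z)%:E - (r%:Z)%:E)) +
   (y + ((n%:Z)%:E - ((n.+1 - s)%N%:Z)%:E)) - (n%:Z)%:E)%E.
Proof.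
move=> s1 sr rn; rewrite addeACA -[RHS]addeA; congr (_ + _)%E.
rewrite -!EFinN -!EFinD; congr EFin.
lia.
Qed.

Local Open Scope ereal_scope.

Theorem theorem2p2 (K : fieldType) (n r s : nat) (n2 : (2 <= n)%N)
    (s1 : (1 <= s)%N) (sr : (s <= r.+1)%N) (rn : (r.+1 <= n)%N)
    (I : mon_ideal K r) (J : mon_ideal K (n.+1 - s)) :
  let IS := mi_ext (low_var (ltnW rn)) I in
  let JS := mi_ext (high_var s1) J in
  let p : \bar int := ((r.+1 - s)%N%:Z)%:E in
  let N : \bar int := (n%:Z)%:E in
  [/\ sdepth (ideal_module I) + sdepth (ideal_module J) - p
        <= sdepth (ideal_module (mi_cap IS JS)) /\
      sdepth (ideal_module I) + sdepth (ideal_module J) - p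
        = sdepth (ideal_module IS) + sdepth (ideal_module JS) - N,
      sdepth (quot_module I) + sdepth (quot_module J) - p
        <= sdepth (quot_module (mi_add IS JS)) /\
      sdepth (quot_module I) + sdepth (quot_module J) - p
        = sdepth (quot_module IS) + sdepth (quot_module JS) - N,
      mine (sdepth (ideal_module IS))
           (sdepth (ideal_module J) + sdepth (quot_module I) - p)
        <= sdepth (ideal_module (mi_add IS JS)) /\
      mine (sdepth (ideal_module IS))
           (sdepth (ideal_module J) + sdepth (quot_module I) - p)
        = mine (sdepth (ideal_module IS))
               (sdepth (ideal_module JS) + sdepth (quot_module IS) - N)
    & mine (sdepth (quot_module IS))
           (sdepth (quot_module J) + sdepth (ideal_module I) - p)
        <= sdepth (quot_module (mi_cap IS JS)) /\
      mine (sdepth (quot_module IS))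
           (sdepth (quot_module J) + sdepth (ideal_module I) - p)
        = mine (sdepth (quot_module IS))
               (sdepth (quot_module JS) + sdepth (ideal_module IS) - N)].
Proof.
move=> IS JS p N.
have low := @low_var_inj r n (ltnW rn); have high := @high_var_inj s n s1.
have shift x y : x + y - p = (x + (N - (r%:Z)%:E)) +
    (y + (N - ((n.+1 - s)%N%:Z)%:E)) - N by apply: sdepth_shift.
have idE (L : mon_ideal K n) : has_exponents (ideal_module L) (ideal_exp L).
  exact: ideal_has_exponents.
have quE (L : mon_ideal K n) :
    has_exponents (quot_module L) (predC (ideal_exp L)).
  exact: quot_has_exponents.
have e1 : sdepth (ideal_module I) + sdepth (ideal_module J) - p =
    sdepth (ideal_module IS) + sdepth (ideal_module JS) - N.
  by rewrite !sdepth_ext_ideal.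
have e2 : sdepth (quot_module I) + sdepth (quot_module J) - p =
    sdepth (quot_module IS) + sdepth (quot_module JS) - N.
  by rewrite !sdepth_ext_quot.
have e3 : sdepth (ideal_module J) + sdepth (quot_module I) - p =
    sdepth (ideal_module JS) + sdepth (quot_module IS) - N.
  by rewrite [X in X - p]addeC [X in X - N]addeC sdepth_ext_ideal //
    sdepth_ext_quot.
have e4 : sdepth (quot_module J) + sdepth (ideal_module I) - p =
    sdepth (quot_module JS) + sdepth (ideal_module IS) - N.
  by rewrite [X in X - p]addeC [X in X - N]addeC sdepth_ext_ideal //
    sdepth_ext_quot.
rewrite e1 e2 e3 e4; split; split=> //.
- by apply: (sdepthI (idE IS) (idE JS) (idE _)) => k; rewrite ideal_exp_cap.
- apply: (sdepthI (quE IS) (quE JS) (quE _)) => k /=.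
  by rewrite ideal_exp_add negb_or.
- apply: (sdepthU (idE IS) (quE IS) (idE JS) (idE _)) => k //=.
  by rewrite ideal_exp_add.
- apply: (sdepthU (quE IS) (idE IS) (quE JS) (quE _)) => k /=.
    by rewrite negbK.
  by rewrite ideal_exp_cap negb_and.
Qed.
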